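(* Let $\Gamma$ and $\Lambda$ be countable discrete groups, and let $\Gamma\curvearrowright X$ and $\Lambda\curvearrowright Y$ be actions by homeomorphisms on compact metric spaces. Suppose $f: X\to Y$ and $\alpha: \Gamma\times X\to \Lambda$ are continuous functions such that $f(\gamma\cdot x)=\alpha(\gamma,x)\cdot f(x)$ for all $x\in X$ and $\gamma\in\Gamma$. Define $$\mathrm{DAD}(f):=\sup_{A\subset Y:\ \mathrm{DAD}(A)=0}\mathrm{DAD}_{free}(f^{-1}(A)),$$ where $\mathrm{DAD}(A)$ is taken with respect to $\Lambda\curvearrowright Y$ and $\mathrm{DAD}_{free}(f^{-1}(A))$ with respect to $\Gamma\curvearrowright X$. Then $$\mathrm{DAD}_{free}(\Gamma\curvearrowright X)\le \mathrm{DAD}(f)+\mathrm{DAD}_{free}(\Lambda\curvearrowright Y).$$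
   Context: The actions are not assumed to be free. Groups are countable and discrete. For a group $\Gamma$, let $\mathcal P_{fs}(\Gamma)$ be the collection of finite symmetric subsets of $\Gamma$ containing the identity. Let $\Gamma\curvearrowright X$ be an action by homeomorphisms on a compact metric space, $A\subset X$ a subset, and $F,S\in\mathcal P_{fs}(\Gamma)$. An $F$-chain in $A$ is a finite sequence $x_0,\dots,x_n$ of points of $A$ with $x_{i+1}=f_{i+1}\cdot x_i$ for some $f_{i+1}\in F$ ($0\le i<n$). Two points of $A$ are in the same $F$-component of $A$ if they are connected by an $F$-chain in $A$. A subset of $X$ is $S$-bounded if it is contained in $S\cdot x$ for some $x\in X$. An open $(n,F,S)$-cover of $A$ is a cover of $A$ by $n+1$ subsets of $A$ that are open in the subspace topology on $A$ and all of whose $F$-components are $S$-bounded. An $n$-dimensional control function for $A$ is a function $\mathcal D_A:\mathcal P_{fs}(\Gamma)\to\mathcal P_{fs}(\Gamma)$ such that for every $F\in\mathcal P_{fs}(\Gamma)$ there is an open $(n,F,\mathcal D_A(F))$-cover of $A$. Then $\mathrm{DAD}(A)$ (also written $\mathrm{DAD}_{free}(A)$) is the least integer $n\ge 0$ such that there is an $n$-dimensional control function for $A$ ($\infty$ if none exists). $\mathrm{DAD}_{free}(\Gamma\curvearrowright X)$ is the smallest integer $d\geq 0$ such that for every finite $F\subset\Gamma$ there is an open cover $U_0,\dots,U_d$ of $X$ such that for all $0\le j\le d$ and $x\in U_j$, the set of $y\in X$ for which there exist $f_1,\dots,f_k\in F$ with $y=f_k\cdots f_1\cdot x$ and $f_{k_0}\cdots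 f_1\cdot x\in U_j$ for all $1\le k_0\le k$ is finite, with cardinality bounded by a constant independent of $x$ ($\infty$ if no such $d$ exists). Equivalently, $\mathrm{DAD}_{free}(\Gamma\curvearrowright X)\le n$ iff there is an $n$-dimensional control function for $A=X$. *)

(* Defs.v *)
From HB Require Import structures.
From mathcomp Require Import all_boot all_algebra.
From mathcomp Require Import all_classical all_reals all_analysis.

Set Implicit Arguments.
Unset Strict Implicit.
Unset Printing Implicit Defensive.

Local Open Scope classical_set_scope.
Local Open Scope card_scope.

(* Each [act g] is a homeomorphism: its inverse is [act g^-1], which is
   continuous as well. *)
Record homeo_action (G : groupType) (X : topologicalType) := HomeoAction {
  act :> G -> X -> X;
  act1 : forall x, act 1%g x = x;
  actM : forall g h x, act (g * h)%g x = act g (act h x);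
  act_continuous : forall g, continuous (act g)
}.

Definition Pfs (G : groupType) : set (set G) :=
  [set F | [/\ finite_set F, F 1%g & forall g, F g -> F g^-1%g]].

(* The least element of [P] as an extended real, +oo if [P] is empty. *)
Definition least_dim (R : realType) (P : set nat) : \bar R :=
  ereal_inf [set (n%:R%:E)%R | n in P].

Section DynamicAsymptoticDimension.
Context {R : realType} {G : groupType} {X : metricType R}.
Variable a : homeo_action G X.

Definition is_chain (F : set G) (A : set X) (n : nat) (x : nat -> X) : Prop :=
  (forall i, (i <= n)%N -> A (x i)) /\
  (forall i, (i < n)%N -> exists2 f, F f & x i.+1 = a f (x i)).

Definition component (F : set G) (A : set X) (x : X) : set X :=
  [set y | exists n, exists z, [/\ is_chain F A n z, z 0%N = x & z n = y]].

Definition is_bounded (S : set G) (B : set X) : Prop :=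
  exists x, B `<=` [set a s x | s in S].

(* [subspace A] has all of [X] as its carrier; as the [U i] are contained in
   [A], openness there is openness for the subspace topology on [A]. *)
Definition open_cover (n : nat) (F S : set G) (A : set X)
    (U : 'I_n.+1 -> set X) : Prop :=
  [/\ \bigcup_i U i = A,
      forall i, open (U i : set (subspace A)) &
      forall i x, U i x -> is_bounded S (component F (U i) x)].

Definition control_function (n : nat) (A : set X) (D : set G -> set G) : Prop :=
  set_fun (@Pfs G) (@Pfs G) D /\
  forall F, Pfs F -> exists U : 'I_n.+1 -> set X, open_cover F (D F) A U.

Definition DAD (A : set X) : \bar R :=
  least_dim R [set n | exists D, control_function n A D].

(* The product f_k ... f_1, where f_i is [f i.-1]. *)
Definition word (f : nat -> G) (k : nat) : G :=
  iteri k (fun i w => f i * w)%g 1%g.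

Definition reachable (F : set G) (U : set X) (x : X) : set X :=
  [set y | exists k, exists f : nat -> G,
    [/\ (0 < k)%N, forall i, (i < k)%N -> F (f i), y = a (word f k) x &
        forall k0, (0 < k0 <= k)%N -> U (a (word f k0) x)]].

(* [#<= `I_N] says: finite, with at most N elements. *)
Definition DAD_action : \bar R :=
  least_dim R [set d | forall F : set G, finite_set F ->
    exists U : 'I_d.+1 -> set X,
      [/\ forall j, open (U j), \bigcup_j U j = [set: X] &
          exists N, forall j x, U j x -> reachable F (U j) x #<= `I_N]].

End DynamicAsymptoticDimension.

Definition DAD_map (R : realType) (G L : groupType) (X Y : metricType R)
    (a : homeo_action G X) (b : homeo_action L Y) (f : X -> Y) : \bar R :=
  ereal_sup [set DAD a (f @^-1` A) | A in [set A | DAD b A = 0%E]].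

(* Main.v *)
(* The set [A] obtained by choosing one point in every orbit of [Lambda] on [Y]
   has dimension 0, as has every finite union of its translates, and [Y] is the
   union of its countably many translates. The bounded relatively open covers
   that the hypothesis gives over these thin sets extend to open sets of [X]. For
   an action that is not free this needs that finitely generated subgroups of
   point stabilisers have bounded orbits nearby, which again follows from the
   hypothesis, applied to thin sequences. Since a union of two bounded families
   is bounded once the scale of the second exceeds the bounds of the first, the
   translates of [A] can be treated one after the other; compactness of [Y] stops
   this after finitely many steps. The result is a cover of [X] by [m + 1] open
   sets that are bounded over all sets [S y], uniformly in [y]. By Kolmogorov's
   trick there are [m + n + 1] such sets covering every point at least [n + 1]
   times, and [m + n + 1] bounded open sets of [Y] covering every point at least
   [m + 1] times; then the sets [f^-1 (U j) `&` V j] cover [X], and they are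
   bounded. *)
Require Import Defs.
From mathcomp Require Import all_boot all_order all_algebra.
From mathcomp Require Import all_classical all_reals all_analysis.

Set Implicit Arguments.
Unset Strict Implicit.
Unset Printing Implicit Defensive.

Import Order.TTheory GRing.Theory Num.Theory.

Local Open Scope classical_set_scope.

(** * Chains and bounded sets *)

Section FiniteSubsets.
Context {G : groupType}.
Implicit Types F H W : seq G.

Definition prodset F H : seq G := [seq (g * h)%g | g <- F, h <- H].

Definition invset F : seq G := [seq g^-1%g | g <- F].

Definition words F n : seq G := iter n (fun W => W ++ prodset F W) [:: 1%g].

Definition symclosure F : seq G := 1%g :: F ++ invset F.

Lemma mem_prodset F H g h : g \in F -> h \in H -> (g * h)%g \in prodset F H.
Proof. by move=> gF hH; apply/allpairsP; exists (g, h). Qed.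

Lemma words1 F n : 1%g \in words F n.
Proof. by elim: n => [|n IH] /=; rewrite ?inE// mem_cat IH. Qed.

Lemma symclosure_sub F : {subset F <= symclosure F}.
Proof. by move=> g gF; rewrite inE mem_cat gF orbT. Qed.

Lemma symclosureV F g : g \in symclosure F -> g^-1%g \in symclosure F.
Proof.
rewrite !inE !mem_cat => /or3P[/eqP ->|gF|/mapP[h hF ->]].
- by rewrite invg1 eqxx.
- by apply/or3P/Or33/mapP; exists g.
- by rewrite invgK hF orbT.
Qed.

End FiniteSubsets.

Section Chains.
Context {R : realType} {G : groupType} {X : metricType R}.
Variable a : homeo_action G X.
Implicit Types (F T Q : seq G) (U V Z : set X) (x y z : X) (p : seq X).

Lemma actK g x : a g^-1%g (a g x) = x.
Proof. by rewrite -actM mulVg act1. Qed.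

Lemma actKV g x : a g (a g^-1%g x) = x.
Proof. by rewrite -actM mulgV act1. Qed.

Definition step F : rel X := fun x y => has (fun g => a g x == y) F.

Lemma stepP F x y : reflect (exists2 g, g \in F & a g x = y) (step F x y).
Proof.
apply: (iffP hasP) => -[g gF]; first by move=> /eqP; exists g.
by move=> <-; exists g.
Qed.

Lemma step_mem F g x : g \in F -> step F x (a g x).
Proof. by move=> gF; apply/stepP; exists g. Qed.

Lemma sub_step F Q x y : {subset F <= Q} -> step F x y -> step Q x y.
Proof. by move=> FQ /stepP[g gF <-]; apply/step_mem/FQ. Qed.

Lemma step_prod F Q x y z : step Q x y -> step F y z -> step (prodset F Q) x z.
Proof.
move=> /stepP[h hQ <-] /stepP[g gF <-]; rewrite -actM.
exact/step_mem/mem_prodset.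
Qed.

Lemma step_inv F x y : step F x y -> step (invset F) y x.
Proof.
move=> /stepP[g gF <-]; apply/stepP; exists g^-1%g; first exact: map_f.
exact: actK.
Qed.

Lemma step_sym F x y : (forall g, g \in F -> g^-1%g \in F) ->
  step F x y -> step F y x.
Proof.
by move=> FV /step_inv; apply: sub_step => _ /mapP[g gF ->]; apply: FV.
Qed.

Definition conn F U x y := exists p,
  [/\ path (step F) x p, forall z, z \in x :: p -> U z & last x p = y].

Lemma conn_refl F U x : U x -> conn F U x x.
Proof. by move=> Ux; exists [::]; split=> // z; rewrite inE => /eqP ->. Qed.

Lemma conn_step F U x y z : conn F U x y -> step F y z -> U z -> conn F U x z.
Proof.
move=> [p [xp pU py]] yz Uz; exists (rcons p z); split.
- by rewrite rcons_path xp py.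
- move=> w; rewrite -rcons_cons mem_rcons inE => /orP[/eqP -> //|]; exact: pU.
- by rewrite last_rcons.
Qed.

Lemma conn_ind F U x (P : X -> Prop) : P x ->
  (forall y z, U y -> U z -> P y -> step F y z -> P z) ->
  forall y, conn F U x y -> P y.
Proof.
move=> Px Pstep y [p]; elim/last_ind: p y => [|p z IH] y.
  by move=> [_ _ <-].
rewrite rcons_path last_rcons => -[/andP[xp pz] pU <-].
have pU' w : w \in x :: p -> U w.
  by move=> wp; apply: pU; rewrite -rcons_cons mem_rcons inE wp orbT.
apply: (Pstep (last x p)) => //.
- by apply: pU'; rewrite mem_last.
- by apply: pU; rewrite -rcons_cons mem_rcons mem_head.
- exact: IH.
Qed.

Lemma conn_trans F U x y z : conn F U x y -> conn F U y z -> conn F U x z.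
Proof.
move=> xy; apply: (@conn_ind F U y (conn F U x)) => // u v _ Uv xu uv.
exact: conn_step xu uv Uv.
Qed.

Lemma conn_mem F U x y : conn F U x y -> U x /\ U y.
Proof.
move=> [p [_ pU <-]]; split; first exact/pU/mem_head.
exact/pU/mem_last.
Qed.

Lemma conn_sub F Q U V x y : {subset F <= Q} -> U `<=` V ->
  conn F U x y -> conn Q V x y.
Proof.
move=> FQ UV xy; have [Ux _] := conn_mem xy.
apply: conn_ind xy => [|u v Uu Uv xu uv]; first exact/conn_refl/UV.
exact: conn_step xu (sub_step FQ uv) (UV _ Uv).
Qed.

Lemma conn_sym F U x y : (forall g, g \in F -> g^-1%g \in F) ->
  conn F U x y -> conn F U y x.
Proof.
move=> FV xy; have [Ux _] := conn_mem xy.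
apply: (@conn_ind F U x (fun y => conn F U y x)) xy => [|u v Uu Uv ux uv].
  exact: conn_refl.
apply: (conn_trans _ ux); apply: (conn_step (conn_refl F Uv) _ Uu).
exact: step_sym uv.
Qed.

Lemma conn_path F U x p z : path (step F) x p ->
  (forall z, z \in x :: p -> U z) -> z \in x :: p -> conn F U x z.
Proof.
move=> + + zp; case/splitPl: zp => p1 p2 <-; rewrite cat_path => /andP[xp1 _] pU.
exists p1; split=> // w; rewrite inE => wp1; apply: pU.
by rewrite inE mem_cat orbA wp1.
Qed.

Lemma conn_uniq F U x y : conn F U x y -> exists p,
  [/\ path (step F) x p, forall z, z \in x :: p -> U z, last x p = y
    & uniq (x :: p)].
Proof.
move=> [p [xp pU <-]]; case/shortenP: xp pU => p' xp' up' p'p pU.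
exists p'; split=> // z; rewrite inE => /orP[/eqP ->|zp'].
  exact/pU/mem_head.
by apply: pU; rewrite inE p'p ?orbT.
Qed.

(** Boundedness of components measured from each of their points instead of from one arbitrary
    centre, so that bounds compose by [step_prod]. *)
Definition ctrl F U T := forall x y, conn F U x y -> step T x y.

Lemma ctrl_sub F Q U V T W : {subset F <= Q} -> U `<=` V -> {subset T <= W} ->
  ctrl Q V T -> ctrl F U W.
Proof.
by move=> FQ UV TW QVT x y xy; apply/(sub_step TW)/QVT/(conn_sub FQ UV).
Qed.

Lemma path_words F x p n : path (step F) x p -> (size p <= n)%N ->
  step (words F n) x (last x p).
Proof.
elim/last_ind: p n => [|p z IH] n.
  by move=> _ _; apply/stepP; exists 1%g; rewrite ?act1 ?words1.
rewrite rcons_path size_rcons last_rcons => /andP[xp pz]; case: n => // n pn.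
apply: (@sub_step (prodset F (words F n))).
  by move=> g gF /=; rewrite mem_cat gF orbT.
exact: step_prod (IH _ xp pn) pz.
Qed.

Lemma ctrl_words F U n :
  (forall x p, path (step F) x p -> (forall z, z \in x :: p -> U z) ->
     uniq (x :: p) -> (size p <= n)%N) ->
  ctrl F U (words F n).
Proof.
move=> short x y /conn_uniq[p [xp pU <- up]].
exact: path_words (short _ _ xp pU up).
Qed.

(** The points of a repetition-free chain are distinct elements of [T x], and [x] itself is one of
    them, hence the strict inequality. *)
Lemma ctrl_size F U T x p : ctrl F U T -> path (step F) x p ->
  (forall z, z \in x :: p -> U z) -> uniq (x :: p) -> (size p < size T)%N.
Proof.
move=> FUT xp pU up.
have /uniq_leq_size := up; move=> /(_ [seq a t x | t <- T]).
rewrite size_map; apply => z zp.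
have /stepP[t tT <-] := FUT _ _ (conn_path xp pU zp).
exact: map_f.
Qed.

(* A chain of [U `|` V] alternates between [U] and [V]; its excursions into [U]
   are bounded by [T], so that deleting them leaves a coarser chain of [V]. *)
Lemma ctrl_setU F U V T T2 : ctrl F U T ->
  ctrl (F ++ prodset F (prodset T F)) V T2 ->
  ctrl F (U `|` V)
    (T ++ prodset (1%g :: prodset T F) (prodset T2 (1%g :: prodset F T))).
Proof.
set Q := F ++ _; set A := _ :: _; set B := _ :: prodset F T.
move=> FUT QVT x y xy.
have FQ : {subset F <= Q} by move=> g gF; rewrite mem_cat gF.
(* [v] and [v'] are the first and the last point so far that count as points of [V]; what follows
   [v'] is an excursion into [U] that need not be finished. *)
pose far z := exists v v', [/\ step B x v, conn Q V v v' &
  v' = z \/ exists2 u, step F v' u & conn F U u z].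
have {xy} : conn F U x y \/ far y.
  have [UVx _] := conn_mem xy.
  apply: (@conn_ind F (U `|` V) x (fun z => conn F U x z \/ far z)) xy
    => [|z w UVz UVw xz zw].
    case: UVx => [Ux|Vx]; first by left; apply: conn_refl.
    right; exists x, x; split; [|exact: conn_refl|by left].
    by apply/stepP; exists 1%g; rewrite ?mem_head ?act1.
  case: UVw => [Uw|Vw].
    case: xz => [xz|[v [v' [xv vv' v'z]]]].
      by left; apply: conn_step xz zw Uw.
    right; exists v, v'; split=> //; right.
    case: v'z => [->|[u v'u uz]]; first by exists w => //; apply: conn_refl.
    by exists u => //; apply: conn_step uz zw Uw.
  right; case: xz => [xz|[v [v' [xv vv' v'z]]]].
    exists w, w; split; [|exact: conn_refl|by left].
    apply: (@sub_step (prodset F T)); last exact: step_prod (FUT _ _ xz) zw.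
    by move=> g gF; rewrite inE gF orbT.
  exists v, w; split=> //; last by left.
  case: v'z => [<-|[u v'u uz]] in zw *.
    exact: conn_step vv' (sub_step FQ zw) Vw.
  apply: conn_step vv' _ Vw; apply: (@sub_step (prodset F (prodset T F))).
    by move=> g gF; rewrite mem_cat gF orbT.
  exact: step_prod (step_prod v'u (FUT _ _ uz)) zw.
case=> [/FUT|[v [v' [xv /QVT vv' v'y]]]].
  by apply: sub_step => g gT; rewrite mem_cat gT.
apply: (@sub_step (prodset A (prodset T2 B))).
  by move=> g gT; rewrite mem_cat gT orbT.
apply: step_prod (step_prod xv vv') _.
case: v'y => [<-|[u v'u /FUT uy]].
  by apply/stepP; exists 1%g; rewrite ?mem_head ?act1.
apply: (@sub_step (prodset T F)); last exact: step_prod v'u uy.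
by move=> g gT; rewrite inE gT orbT.
Qed.

End Chains.

(** * Metric and dimension preliminaries *)

Section MetricTools.
Context {R : realType} {X : metricType R}.
Implicit Types (U V W : set X) (x y z : X).

Lemma open_near U : (forall x, U x -> \forall y \near x, U y) -> open U.
Proof. by move=> nU; rewrite openE => x /nU. Qed.

Lemma open_metric_ball x (r : R) : open (ball x r).
Proof.
apply: open_near => y; rewrite ballEmdist/= => xy.
have r0 : (0 < r - mdist x y)%R by rewrite subr_gt0.
have := nbhsx_ballx y _ r0; apply: filterS => z; rewrite !ballEmdist/= => yz.
by rewrite (le_lt_trans (metric_triangle x y z))// addrC -ltrBrDr.
Qed.

Lemma nbhs_double_ball U x : open U -> U x ->
  exists2 r : R, (0 < r)%R & ball x (r + r) `<=` U.
Proof.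
move=> oU Ux; have /nbhs_ballP[e /= e0 xeU] := open_nbhs_nbhs (conj oU Ux).
by exists (e / 2)%R; rewrite ?divr_gt0 -?splitr.
Qed.

Lemma near_seq (T : eqType) (s : seq T) (P : T -> X -> Prop) x :
  (forall t, t \in s -> \forall y \near x, P t y) ->
  \forall y \near x, forall t, t \in s -> P t y.
Proof.
elim: s => [|t s IH] sP; first by near=> y.
have Pt := sP _ (mem_head t s).
have /IH Ps u : u \in s -> \forall y \near x, P u y.
  by move=> us; apply: sP; rewrite inE us orbT.
near=> y => u; rewrite inE => /orP[/eqP ->|].
  by near: y.
by move: u; near: y.
Unshelve. all: by end_near. Qed.

Lemma seq_cluster : compact [set: X] -> forall u : nat -> X, exists x,
  forall V, nbhs x V -> forall N, exists2 k, (N <= k)%N & V (u k).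
Proof.
move=> cX u; have [x [_ cx]] := cX (u @ \oo)%classic _ (@filterT _ _ _).
exists x => V xV N.
have /cx/(_ xV)[_ [[k /= Nk <-] Vuk]] : (u @ \oo) (u @` [set k | (N <= k)%N]).
  by exists N => // k /= Nk; exists k.
by exists k.
Qed.

End MetricTools.

(** The complement is the image under [f] of the closed, hence compact, complement of [W]. *)
Lemma tube {R : realType} {X Y : metricType R} (f : X -> Y) (W : set X) :
  compact [set: X] -> continuous f -> open W ->
  open [set y | forall x, f x = y -> W x].
Proof.
move=> cX cf oW; rewrite (_ : [set y | _] = ~` (f @` ~` W)).
  apply: closed_openC; apply: compact_closed; first exact: metric_hausdorff.
  apply: continuous_compact; first exact: continuous_subspaceT.
  by apply: (subclosed_compact _ cX) => //; apply: open_closedC.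
apply/seteqP; split=> y /= yW; first by move=> [x nWx /yW].
by move=> x xy; apply: contrapT => nWx; apply: yW; exists x.
Qed.

Section LeastDim.
Variable R : realType.
Implicit Type P : set nat.

Lemma least_dim_ge0 P : (0 <= least_dim R P)%E.
Proof. by apply: le_ereal_inf_tmp => _ [n _ <-]; rewrite lee_fin. Qed.

Lemma least_dim_le P n : P n -> (least_dim R P <= n%:R%:E)%E.
Proof. by move=> Pn; apply: ereal_inf_lbound; exists n. Qed.

Lemma least_dim_ltn P n : (least_dim R P < n%:R%:E)%E ->
  exists2 k, (k < n)%N & P k.
Proof.
move=> Pn; apply: contrapT => nP; move: Pn; rewrite ltNge => /negP; apply.
apply: le_ereal_inf_tmp => _ [k Pk <-]; rewrite lee_fin ler_nat leqNgt.
by apply/negP => kn; apply: nP; exists k.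
Qed.

End LeastDim.

Lemma card_ge_uniq (T : eqType) (s : seq T) :
  uniq s -> (`I_(size s) #<= [set` s])%card.
Proof.
move=> us; rewrite (_ : `I_(size s) = index^~ s @` [set` s]) ?card_image_le//.
apply/seteqP; split=> [i /= ils|_ [t /= ts <-]]; last by rewrite index_mem.
by case: s us ils => // t s us ils; exists (nth t (t :: s) i);
  rewrite ?mem_nth ?index_uniq.
Qed.

Lemma card_le_seq (T : eqType) (s : seq T) : ([set` s] #<= `I_(size s))%card.
Proof.
case: s => [|t s]; first by rewrite set_nil card_ge0.
rewrite [X in (X #<= _)%card](_ : _ = nth t (t :: s) @` `I_(size s).+1).
  exact: card_image_le.
apply/seteqP; split=> [u /= us|_ [i /= si <-]]; last exact: mem_nth.
exists (index u (t :: s)); last exact: nth_index.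
by move: us; rewrite -index_mem.
Qed.

Section Dimension.
Context {R : realType} {G : groupType} {X : metricType R}.
Variable a : homeo_action G X.
Implicit Types (F T : seq G) (U A : set X) (x y z : X).

Lemma component_conn F U x y : component a [set` F] U x y <-> conn a F U x y.
Proof.
split=> [[n [z [[zU zF] <- <-]]]|[p [xp pU <-]]].
  elim: n zU zF => [|n IH] zU zF; first exact/conn_refl/zU.
  apply: conn_step (IH _ _) _ (zU _ _) => // [i /leqW/zU //|i /leqW/zF //|].
  by have [f fF ->] := zF _ (ltnSn n); apply: step_mem.
exists (size p), (nth x (x :: p)); split=> //; last by rewrite nth_last.
split=> [i ip|i ip]; first by apply/pU/mem_nth.
by have /pathP - /(_ x i ip) /stepP[g gF gi] := xp; exists g.
Qed.

Lemma Pfs_symclosure F : Pfs [set` symclosure F].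
Proof.
by split=> [||g]; [exact: finite_seq|exact: mem_head|exact: symclosureV].
Qed.

Lemma DAD_eq0 A : (forall F, exists T, ctrl a F A T) -> DAD a A = 0%E.
Proof.
move=> /choice[T AT]; apply/eqP; rewrite eq_le least_dim_ge0 andbT.
(* The control function needs a value at every set; outside [Pfs] the default is [[::]], whose
   [symclosure] is again in [Pfs]. *)
have /choice[D DP] (F : set G) : exists S : seq G,
    Pfs F -> exists2 s, F = [set` s] & S = T s.
  have [[/finite_seqP[s Fs] _ _]|nF] := pselect (Pfs F); last by exists [::].
  by exists (T s) => _; exists s.
apply: (@least_dim_le R _ 0); exists (fun E => [set` symclosure (D E)]); split=> [E _|E PE].
  exact: Pfs_symclosure.
exists (fun=> A); split.
- by apply/seteqP; split=> [x [//]|x Ax]; exists ord0.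
- by move=> _; apply: open_subspaceT.
- move=> _ x Ax; exists x => y; have [s -> ->] := DP _ PE.
  move=> /component_conn/AT/stepP[t tT <-]; exists t => //=.
  exact: symclosure_sub.
Qed.

Lemma DAD_covers A m : (DAD a A < m.+1%:R%:E)%E -> forall F, exists T,
  exists U : nat -> set X, [/\ forall j, open (U j),
    forall x, A x -> exists2 j, (j <= m)%N & U j x &
    forall j, ctrl a F (U j `&` A) T].
Proof.
move=> /least_dim_ltn[n nm [D [PD cD]]] F.
have [U [UA oU bU]] := cD _ (Pfs_symclosure F).
have [/finite_seqP[T DT] _ _] := PD _ (Pfs_symclosure F).
have /choice[V VP] (i : 'I_n.+1) : exists V : set X,
    open V /\ V `&` A = U i.
  have /open_subspaceP[V oV VU] := oU i; exists V; split=> //.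
  by rewrite VU; apply: setIidl; rewrite -UA => x Ux; exists i.
(* [inord] extends the family from indices up to [n] to all of [nat]. A bounded set lies in [T z]
   for some [z], so one passes from [x] back to [z] and on to [y]. *)
exists (prodset T (invset T)), (V \o inord); split=> [j|x|j x y xy].
- by have [] := VP (inord j).
- rewrite -{1}UA => -[i _ Uix]; exists i.
    exact: leq_trans (leq_ord i) nm.
  by rewrite /= inord_val; have [_ VU] := VP i; move: Uix; rewrite -VU => -[].
have [_ VU] := VP (inord j); rewrite /= VU in xy.
have [Ux _] := conn_mem xy; have [z] := bU _ _ Ux; rewrite DT => xz.
have cxy : component a [set` symclosure F] (U (inord j)) x y.
  exact/component_conn/(conn_sub (@symclosure_sub _ F) _ xy).
have /xz[t tT tz] := cxy.
have /xz[s sT sz] : component a [set` symclosure F] (U (inord j)) x x.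
  exact/component_conn/conn_refl.
apply: (@step_prod _ _ _ _ _ _ _ z).
  by rewrite -sz; apply/step_inv/step_mem.
by rewrite -tz; apply: step_mem.
Qed.

Lemma actword (g : nat -> G) x k :
  a (word g k.+1) x = a (g k) (a (word g k) x).
Proof. by rewrite -actM. Qed.

(** The points of a chain after its start are reachable, so repetition-free chains have length at
    most [N] and words of that length give the bound. *)
Lemma DAD_action_covers n : (DAD_action a < n.+1%:R%:E)%E -> forall F, exists T,
  exists U : nat -> set X, [/\ forall j, open (U j),
    forall x, exists2 j, (j <= n)%N & U j x &
    forall j, ctrl a F (U j) T].
Proof.
move=> /least_dim_ltn[d dn dP] F.
have [U [oU UT [N UN]]] := dP _ (finite_seq F).
exists (words F N), (U \o inord); split=> [j|x|j]; first exact: oU.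
  have [i _ Ux] : (\bigcup_j U j) x by rewrite UT.
  by exists i; rewrite /= ?inord_val//; apply: leq_trans (leq_ord i) dn.
apply: ctrl_words => x p xp pU /andP[_ up].
have := UN (inord j) x (pU _ (mem_head _ _)).
suff pN : [set` p] `<=` reachable a [set` F] (U (inord j)) x.
  move=> /(card_le_trans (subset_card_le pN)).
  by move=> /(card_le_trans (card_ge_uniq up)); rewrite card_le_II.
move=> z /= zp; have ip : (index z p < size p)%N by rewrite index_mem.
have /choice[g gP] (i : nat) : exists g, (i < size p)%N ->
    g \in F /\ a g (nth x (x :: p) i) = nth x p i.
  have [ip'|_] := ltnP i (size p); last by exists 1%g.
  by have /pathP - /(_ x i ip') /stepP[g gF gi] := xp; exists g.
have gw k : (k <= size p)%N -> a (word g k) x = nth x (x :: p) k.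
  elim: k => [|k IH] kp; first exact: act1.
  by rewrite actword IH 1?ltnW//; have [_ ->] := gP _ kp.
exists (index z p).+1, g; split=> //.
- by move=> i ii; have [] := gP _ (leq_trans ii ip).
- by rewrite gw//= nth_index.
- move=> k /andP[_ kp]; rewrite gw ?(leq_trans kp)//.
  by apply/pU/mem_nth; rewrite /= ltnS (leq_trans kp).
Qed.

Lemma DAD_action_le n :
  (forall F, exists T, exists U : nat -> set X, [/\ forall j, open (U j),
    forall x, exists2 j, (j <= n)%N & U j x &
    forall j, ctrl a F (U j) T]) ->
  (DAD_action a <= n%:R%:E)%E.
Proof.
move=> H; apply: least_dim_le => _ /finite_seqP[F ->].
have [T [U [oU UT FUT]]] := H F.
exists (fun j => U j); split=> [//||].
  apply/seteqP; split=> // x _; have [j jn Ujx] := UT x.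
  by exists (Ordinal (jn : (j < n.+1)%N)).
exists (size T) => j x Ujx.
rewrite -(size_map (fun t => a t x)); apply: card_le_trans (card_le_seq _).
apply: subset_card_le => y [k [f [k0 fF -> fU]]] /=.
have xU i : (i <= k)%N -> conn a F (U j) x (a (word f i) x).
  elim: i => [|i IH] ik; first by rewrite act1; apply: conn_refl.
  have wi : U j (a (word f i.+1) x) by apply: fU.
  apply: conn_step (IH (ltnW ik)) _ wi.
  by rewrite actword; apply/step_mem/fF.
by have /FUT/stepP[t tT <-] := xU k (leqnn k); apply: map_f.
Qed.

End Dimension.

(** * Orbits near fixed points and thin sets *)

Section LocalStability.
Context {R : realType} {G : groupType} {X : metricType R}.
Variable a : homeo_action G X.
Implicit Types (E F T : seq G) (U A : set X) (x y z w : X) (p : seq X).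

Lemma mem_path_words F x p z n : path (step a F) x p -> z \in x :: p ->
  (size p <= n)%N -> step a (words F n) x z.
Proof.
move=> + zp; case/splitPl: zp => p1 p2 <-.
rewrite cat_path size_cat => /andP[xp1 _] pn.
by apply: path_words => //; apply: leq_trans pn; apply: leq_addr.
Qed.

Lemma words_fix E x : (forall e, e \in E -> a e x = x) ->
  forall n g, g \in words E n -> a g x = x.
Proof.
move=> Ex; elim=> [|n IH] g /=; first by rewrite inE => /eqP ->; apply: act1.
rewrite mem_cat => /orP[/IH//|/allpairsP[[e h] [/= /Ex ex /IH hx ->]]].
by rewrite actM hx.
Qed.

Lemma near_act g x U : nbhs (a g x) U -> \forall w \near x, U (a g w).
Proof. by move=> gxU; exact: (@act_continuous _ _ a g x _ gxU). Qed.

Lemma words_sub E F n : {subset E <= F} -> {subset words E n <= words F n}.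
Proof.
move=> EF; elim: n => [//|n IH] g /=; rewrite !mem_cat => /orP[/IH ->//|].
move=> /allpairsP[[e h] [/= /EF eF /IH hF ->]].
by rewrite mem_prodset ?orbT.
Qed.

Lemma words_conn E n x g : g \in words E n -> conn a E setT x (a g x).
Proof.
elim: n g => [|n IH] g /=.
  by rewrite inE => /eqP ->; rewrite act1; apply: conn_refl.
rewrite mem_cat => /orP[/IH//|/allpairsP[[e h] [/= eE /IH xh ->]]].
by rewrite actM; apply: conn_step xh (step_mem _ _ eE) _.
Qed.

Definition short_orbit E N w := forall p, path (step a E) w p ->
  uniq (w :: p) -> (size p < N)%N.

Lemma not_short_orbit E N w : ~ short_orbit E N w -> exists p,
  [/\ path (step a E) w p, uniq (w :: p) & size p = N].
Proof.
move=> nw; apply: contrapT => nP; apply: nw => p wp up; rewrite ltnNge.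
apply/negP => pN; apply: nP; exists (take N p); split.
- exact: take_path.
- exact: (take_uniq N.+1 up).
- exact: size_takel.
Qed.

Lemma short_orbit_conn E N w w' : short_orbit E N w ->
  conn a E setT w w' -> step a (words E N) w w'.
Proof.
move=> wN /conn_uniq[p [wp _ <- up]]; apply: path_words => //.
exact/ltnW/wN.
Qed.

(** Near a common fixed point of [E] words of length up to [size T] keep [w] in [U], so a path of
    this length in [A] contradicts [ctrl_size]. Longer paths can be truncated, so excluding one
    length suffices. *)
Lemma near_fixed_point E T U A x : ctrl a E (U `&` A) T -> open U -> U x ->
  (forall e, e \in E -> a e x = x) ->
  \forall w \near x, forall p, path (step a E) w p ->
    (forall z, z \in w :: p -> A z) -> uniq (w :: p) -> size p <> size T.
Proof.
move=> UAT oU Ux Ex.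
have nU : \forall w \near x, forall g, g \in words E (size T) -> U (a g w).
  apply: near_seq => g gE; apply: near_act; apply: open_nbhs_nbhs.
  by rewrite (words_fix Ex gE).
apply: filterS nU => w wU p wp pA up pT.
suff pUA z : z \in w :: p -> (U `&` A) z.
  by have := ctrl_size UAT wp pUA up; rewrite pT ltnn.
move=> zp; split; last exact: pA.
have /stepP[g gE <-] := mem_path_words wp zp (leqnn _).
by apply: wU; rewrite -pT.
Qed.

Lemma DAD_eq0_seq A :
  (forall F, exists N, forall x, A x -> exists l : seq X, (size l <= N)%N /\
     forall y, conn a F A x y -> y \in l) -> DAD a A = 0%E.
Proof.
move=> AN; apply: DAD_eq0 => F; have [N FN] := AN F.
exists (words F N); apply: ctrl_words => x p xp pA up.
have [l [lN xl]] := FN _ (pA _ (mem_head _ _)).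
apply: ltnW; apply: leq_trans lN; apply: (uniq_leq_size up) => z zp.
exact: xl (conn_path xp pA zp).
Qed.

End LocalStability.

Lemma countable_enum {G : groupType} : countable [set: G] ->
  exists e : nat -> G, forall F : seq G, exists c, forall g, g \in F ->
    exists2 i, (i < c)%N & g = e i.
Proof.
move=> /countable_injP[h hinj].
have /choice[e eP] (i : nat) : exists g : G, forall g', h g' = i -> g' = g.
  have [[g <-]|nh] := pselect (exists g, h g = i).
    by exists g => g' /hinj; apply; rewrite in_setT.
  by exists 1%g => g' hg'; case: nh; exists g'.
exists e => F; exists (\max_(g <- F) (h g).+1) => g gF; exists (h g).
  exact: (@leq_bigmax_seq _ F xpredT (fun g => (h g).+1)).
exact: eP.
Qed.

Section ThinSubsequence.
Context {R : realType} {G : groupType} {X : metricType R}.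
Variable a : homeo_action G X.
Hypothesis countable_G : countable [set: G].

(** Indices are chosen greedily: the [j]-th translate set avoids the images of [x0] and of the
    earlier ones under the first [j] elements of [G]. For a given [F] all but finitely many of them
    are then [F]-isolated, and the rest form a finite set. *)
Lemma thin_subsequence (v : nat -> X) (x0 : X) (S : seq G) : exists I : set nat,
  (forall N, exists2 k, (N <= k)%N & I k) /\
  DAD a [set x | x = x0 \/ exists2 k, I k & step a S (v k) x] = 0%E.
Proof.
(* If some value recurs at arbitrarily large indices, the resulting set is finite; otherwise the
   sequence eventually leaves every finite set. *)
have [[y vy]|nv] := pselect (exists y, forall N, exists2 k, (N <= k)%N & v k = y).
  exists [set k | v k = y]; split; first exact: vy.
  apply: DAD_eq0_seq => F; exists (size S).+1 => x _.
  exists (x0 :: [seq a s y | s <- S]); split; first by rewrite /= size_map.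
  move=> z xz; have [_ [->|[k <- /stepP[s sS <-]]]] := conn_mem xz.
    exact: mem_head.
  by rewrite inE; apply/orP; right; apply/mapP; exists s.
have {}nv (l : seq X) : exists N, forall k, (N <= k)%N -> v k \notin l.
  elim: l => [|y l [N lN]]; first by exists 0%N.
  have [M yM] : exists M, forall k, (M <= k)%N -> v k <> y.
    apply: contrapT => nM; apply: nv; exists y => K.
    apply: contrapT => nK; apply: nM; exists K => k Kk vk.
    by apply: nK; exists k.
  exists (maxn M N) => k; rewrite geq_max => /andP[/yM/eqP Mk /lN Nk].
  by rewrite inE negb_or Mk.
have [e eP] := countable_enum countable_G.
pose Lam j := [seq e i | i <- iota 0 j].
(* [v k] avoids [s^-1 g s' y] exactly when [s (v k)] avoids [g s' y]; the extra [1] accounts for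
   [x0]. *)
pose bad j := prodset (invset S) (prodset (Lam j) (1%g :: S)).
pose near_pts l := [seq a g y | g <- bad (size l), y <- x0 :: [seq v k | k <- l]].
have /choice[nxt nxtP] (l : seq nat) : exists k,
    all (fun i => i < k)%N l /\ v k \notin near_pts l.
  have [N vN] := nv (near_pts l); exists (maxn N (\max_(i <- l) i.+1)).
  split; last exact/vN/leq_maxl.
  apply/allP => i il; rewrite leq_max; apply/orP; right.
  exact: (@leq_bigmax_seq _ l xpredT (fun i => i.+1)).
pose L := fix L n := if n is n'.+1 then nxt (L n') :: L n' else [::].
pose K i := nxt (L i).
have sL n : size (L n) = n by elim: n => //= n ->.
have mL i n : (i < n)%N -> K i \in L n.
  elim: n => // n IH; rewrite ltnS leq_eqVlt inE => /orP[/eqP ->|/IH ->].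
    by rewrite eqxx.
  by rewrite orbT.
have LmP k n : k \in L n -> exists2 i, (i < n)%N & k = K i.
  elim: n => // n IH; rewrite inE => /orP[/eqP ->|/IH[i ni ->]]; first by exists n.
  by exists i => //; apply: ltnW.
have K_ge i : (i <= K i)%N.
  elim: i => // i IH; apply: leq_ltn_trans IH _.
  by have [/allP + _] := nxtP (L i.+1); apply; apply: mL.
have sep j g s s' y : g \in Lam j -> s \in S -> s' \in 1%g :: S ->
    (y = x0 \/ exists2 i, (i < j)%N & y = v (K i)) ->
    a s (v (K j)) <> a g (a s' y).
  move=> gj sS s'S yj sy; have [_ /negP] := nxtP (L j); apply.
  apply/allpairsP; exists ((s^-1 * (g * s'))%g, y); split=> /=.
  - by rewrite sL; do 2?apply: mem_prodset => //; apply: map_f.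
  - rewrite inE; case: yj => [->|[i ij ->]]; first by rewrite eqxx.
    by apply/orP; right; apply/map_f/mL.
  - by rewrite -[v _](actK a s) -/(K j) sy !actM.
exists (range K); split; first by move=> N; exists (K N) => //; exists N.
apply: DAD_eq0_seq => F; have [c cP] := eP (symclosure F).
(* The first [c] elements of [G] contain [symclosure F]; [Bc] collects [x0] and the points of the
   first [c] chosen indices. *)
pose Bc := x0 :: [seq a s y | s <- S, y <- [seq v k | k <- L c]].
exists (size Bc + size S)%N => x Ax.
have FLam g j : g \in symclosure F -> (c <= j)%N -> g \in Lam j.
  move=> /cP[i ic ->] cj; apply: map_f.
  by rewrite mem_iota add0n (leq_trans ic).
have Bc_far z j s g : z \in Bc -> (c <= j)%N -> s \in S -> g \in symclosure F ->
    a s (v (K j)) <> a g z.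
  move=> zB cj sS gF; move: zB; rewrite inE => /orP[/eqP ->|].
    rewrite -[x0](act1 a); apply: (sep j) => //; [exact: FLam|exact: mem_head|].
    by left.
  move=> /allpairsP[[s' y] [/= s'S /mapP[k /LmP[i ic ->] ->] ->]].
  apply: (sep j) => //; [exact: FLam|by rewrite inE s'S orbT|].
  by right; exists i => //; apply: leq_trans cj.
have AP z : z = x0 \/ (exists2 k, range K k & step a S (v k) z) ->
    z \in Bc \/ exists j s, [/\ (c <= j)%N, s \in S & z = a s (v (K j))].
  case=> [->|[_ [j _ <-] /stepP[s sS <-]]]; first by left; apply: mem_head.
  have [jc|cj] := ltnP j c; last by right; exists j, s.
  left; rewrite inE; apply/orP; right; apply/allpairsP; exists (s, v (K j)).
  by split=> //=; apply/map_f/mL.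
have [xB|[j [s [cj sS xs]]]] := AP _ Ax.
  exists Bc; split=> [|z]; first exact: leq_addr.
  apply: (@conn_ind _ _ _ _ _ _ _ (fun z => z \in Bc)) => // y {}z _ Az yB /stepP[g gF yz].
  have [//|[j [s [cj sS zs]]]] := AP _ Az; exfalso.
  by apply: (Bc_far y j s g) => //; rewrite ?symclosure_sub// -zs yz.
exists [seq a s (v (K j)) | s <- S]; split=> [|z].
  by rewrite size_map leq_addl.
apply: (@conn_ind _ _ _ _ _ _ _ (fun z => z \in [seq a s (v (K j)) | s <- S]))
  => [|y {}z _ Az /mapP[s1 s1S ys] /stepP[g gF yz]].
  by apply/mapP; exists s.
have gF' := symclosure_sub gF.
have zy : y = a g^-1%g z by rewrite -yz actK.
have [zB|[i [s2 [ci s2S zs]]]] := AP _ Az.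
  exfalso; apply: (Bc_far z j s1 g^-1%g) => //; first exact: symclosureV.
  by rewrite -ys.
have [ij|ji|ij] := ltngtP i j.
- exfalso; apply: (sep j g^-1%g s1 s2 (v (K i))) => //.
  + by apply: FLam => //; apply: symclosureV.
  + by rewrite inE s2S orbT.
  + by right; exists i.
  + by rewrite -ys -zs.
- exfalso; apply: (sep i g s2 s1 (v (K j))) => //; first exact: FLam.
  + by rewrite inE s1S orbT.
  + by right; exists j.
  + by rewrite -ys -zs.
- by apply/mapP; exists s2; rewrite ?zs ?ij.
Qed.

End ThinSubsequence.

(** * Multiplicity of covers *)

Section Multiplicity.
Context {R : realType} {G : groupType} {X : metricType R}.
Variable a : homeo_action G X.
Hypothesis compact_X : compact [set: X].
Implicit Types (F T : seq G) (U V K : nat -> set X) (x y z : X).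

Definition mult k V x : nat := \sum_(j < k) `[< V j x >].

Lemma mult_le k V W x y : (forall j, (j < k)%N -> V j x -> W j y) ->
  (mult k V x <= mult k W y)%N.
Proof.
move=> VW; apply: leq_sum => j _; case: asboolP => // Vx.
by rewrite asboolT//; apply: VW.
Qed.

Lemma mult_eq k V W x : (forall j, V j x -> W j x) ->
  (mult k W x <= mult k V x)%N -> forall j, (j < k)%N -> W j x -> V j x.
Proof.
move=> VW WV j jk Wx; apply: contrapT => nVx; move: WV; apply/negP.
rewrite -ltnNge /mult (bigD1 (Ordinal jk))//= [ltnRHS](bigD1 (Ordinal jk))//=.
rewrite (asboolF nVx) (asboolT Wx) add0n add1n ltnS; apply: leq_sum => i _.
by case: asboolP => // Vx; rewrite asboolT//; apply: VW.
Qed.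

Lemma mult_gt0 k V x : (0 < mult k V x)%N -> exists2 j, (j < k)%N & V j x.
Proof.
move=> V0; apply: contrapT => nV; move: V0; rewrite lt0n => /eqP; apply.
apply: big1 => j _; rewrite asboolF// => Vx; apply: nV; by exists j.
Qed.

(** A Lebesgue number argument: the points whose ball of radius [1/(l+1)] lies in [V j] form a
    closed set, and by compactness some [l] keeps the multiplicity at least [q] everywhere. *)
Lemma mult_shrink k q V : (forall j, open (V j)) ->
  (forall x, q <= mult k V x)%N -> exists K,
  [/\ forall j, closed (K j), forall j, K j `<=` V j &
    forall x, (q <= mult k K x)%N].
Proof.
move=> oV Vq; pose K l j := [set x | ball x (l.+1%:R^-1 : R)%R `<=` V j].
have l0 l : (0 < l.+1%:R^-1 :> R)%R by rewrite invr_gt0.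
suff [l Kl] : exists l, forall x, (q <= mult k (K l) x)%N.
  exists (K l); split=> // j; last first.
    by move=> x; apply; apply: ballxx.
  rewrite -[K l j]setCK; apply: open_closedC; apply: open_near => x /= nKx.
  have [z xz nVz] : exists2 z, ball x (l.+1%:R^-1 : R)%R z & ~ V j z.
    apply: contrapT => nz; apply: nKx => z xz.
    by apply: contrapT => nVz; apply: nz; exists z.
  have := open_nbhs_nbhs (conj (open_metric_ball z l.+1%:R^-1%R) (ball_sym xz)).
  by apply: filterS => w /ball_sym wz Kw; apply/nVz/Kw.
apply: contrapT => nK; have /choice[u uP] (l : nat) : exists x,
    (mult k (K l) x < q)%N.
  apply: contrapT => nx; apply: nK; exists l => x; rewrite leqNgt.
  by apply/negP => xq; apply: nx; exists x.
have [x cx] := seq_cluster compact_X u.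
have /choice[e eP] (j : nat) : exists e : R, V j x ->
    (0 < e)%R /\ ball x (e + e) `<=` V j.
  have [Vx|] := pselect (V j x); last by exists 0%R.
  by have [e e0 xe] := nbhs_double_ball (oV j) Vx; exists e.
have near_e : \forall w \near x, forall j, j \in iota 0 k -> V j x ->
    ball x (e j) w.
  apply: near_seq => j _; have [Vx|nV] := pselect (V j x); last by near=> w.
  by have [e0 _] := eP _ Vx; apply: filterS (nbhsx_ballx x _ e0).
have [l Nl xl] := cx _ near_e (\max_(j <- iota 0 k) Num.trunc (e j)^-1).
have := uP l; apply/negP; rewrite -leqNgt; apply: leq_trans (Vq x) _.
apply: mult_le => j jk Vx; have [e0 xeV] := eP _ Vx.
have jk' : j \in iota 0 k by rewrite mem_iota.
move=> z uz; apply/xeV/(ball_triangle (xl j jk' Vx)); apply: le_ball uz.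
rewrite -[leRHS]invrK lef_pV2 ?posrE ?invr_gt0//.
apply/ltW/(lt_le_trans (truncnS_gt _)); rewrite ler_nat ltnS.
apply: leq_trans Nl.
exact: (@leq_bigmax_seq _ _ xpredT (fun j => Num.trunc (e j)^-1)).
Unshelve. all: by end_near. Qed.

Lemma mult_usc k q K : (forall j, closed (K j)) ->
  open [set x | (mult k K x <= q)%N].
Proof.
move=> cK; apply: open_near => x /= xq.
have : \forall w \near x, forall j, j \in iota 0 k -> K j w -> K j x.
  apply: near_seq => j _; have [Kx|nK] := pselect (K j x); first by near=> w.
  apply: filterS (open_nbhs_nbhs (conj (closed_openC (cK j)) nK)) => w nKw Kw.
  by case: nKw.
apply: filterS => w wK; apply: leq_trans xq; apply: mult_le => j jk.
by apply: wK; rewrite mem_iota.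
Unshelve. all: by end_near. Qed.

(** The index [i] is a scale: boundedness is required only inside members of [Zs i], and moving by
    [F] leads to another scale. Over [X] the members will be the preimages of the sets [S y], over
    [Y] only the whole space. *)
Variables (I : Type) (Zs : I -> set (set X)).
Hypothesis Zs_enlarge : forall F i, exists i', forall Z, Zs i Z ->
  exists2 Z', Zs i' Z' & forall g z, g \in F -> Z z -> Z' (a g z).

Definition bounded_family k q := forall F i, exists T, exists V,
  [/\ forall j, open (V j), forall x, (q <= mult k V x)%N &
    forall j Z, Zs i Z -> ctrl a F (V j `&` Z) T].

(* Kolmogorov's trick: enlarge the given sets by [F]; the points that lie in
   only [q] of them form the additional set, on which membership in the given
   sets is constant along [F]-chains. *)
Lemma bounded_familyS k q : (0 < q)%N -> bounded_family k q ->
  bounded_family k.+1 q.+1.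
Proof.
move=> q0 famq F0 i; pose F := symclosure F0.
have F1 : 1%g \in F by exact: mem_head.
have [i' Zi'] := Zs_enlarge F i.
(* A step of [F] in an enlarged set becomes a step of [F F F] between translates in the original
   set. *)
have [T [V [oV Vq FVT]]] := famq (prodset F (prodset F F)) i'.
have [K [cK KV Kq]] := mult_shrink oV Vq.
pose hat (W : nat -> set X) j := [set x | exists2 g, g \in F & W j (a g x)].
have sub_hat W j : W j `<=` hat W j by move=> x Wx; exists 1%g; rewrite ?act1.
(* Counting closed shrinkings makes [Vnew] open; a point outside it lies in more than [q] of the
   sets [hat K j], hence of the sets [hat V j]. *)
pose Vnew := [set x | (mult k (hat K) x <= q)%N].
pose W j := if (j < k)%N then hat V j else Vnew.
have multW x : mult k.+1 W x = (mult k (hat V) x + `[< Vnew x >])%N.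
  rewrite /mult big_ord_recr /= {2}/W ltnn; congr (_ + _)%N.
  by apply: eq_bigr => j _; rewrite /W ltn_ord.
have chat j : closed (hat K j).
  rewrite (_ : hat K j = \big[setU/set0]_(g <- F) [set x | K j (a g x)]).
    apply: closed_bigsetU => g _.
    exact: (closed_comp (fun x _ => @act_continuous _ _ a g x) (cK j)).
  apply/seteqP; split=> x; rewrite -bigcup_seq.
    by move=> [g gF Kx]; exists g.
  by move=> [g gF Kx]; exists g.
have hatVT j Z : Zs i Z ->
    ctrl a F (hat V j `&` Z) (prodset F (prodset T F)).
  move=> /Zi'[Z' Z'i FZ] x y xy; have [[[g gF Vgx] Zx] _] := conn_mem xy.
  have [h hF gxhy] : exists2 h, h \in F &
      conn a (prodset F (prodset F F)) (V j `&` Z') (a g x) (a h y).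
    apply: (@conn_ind _ _ _ _ _ _ _ (fun y => exists2 h, h \in F &
      conn a (prodset F (prodset F F)) (V j `&` Z') (a g x) (a h y))) xy.
      by exists g => //; apply: conn_refl; split=> //; apply: FZ.
    move=> u v _ [[h' h'F Vv] Zv] [h hF gxu] /stepP[s sF uv]; exists h' => //.
    apply: conn_step gxu _ _; last by split=> //; apply: FZ.
    apply/stepP; exists (h' * (s * h^-1))%g; last by rewrite !actM actK uv.
    by do 2?apply: mem_prodset => //; apply: symclosureV.
  have /stepP[t tT gxt] := FVT _ _ Z'i _ _ gxhy.
  apply/stepP; exists (h^-1 * (t * g))%g; last by rewrite !actM gxt actK.
  by do 2?apply: mem_prodset => //; apply: symclosureV.
have VnewT Z : Zs i Z -> ctrl a F (Vnew `&` Z) T.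
  move=> /Zi'[Z' Z'i FZ] x y xy; have [[_ Zx] _] := conn_mem xy.
  have ZZ' z : Z z -> Z' z by move=> Zz; rewrite -[z](act1 a); apply: FZ.
  (* As [q] is positive, [x] lies in some [K j]; membership in [K j] passes along the chain, which
     thus stays in [V j]. *)
  have [|j jk Kx] := @mult_gt0 k K x; first exact: leq_trans (Kq x).
  apply: (FVT j _ Z'i).
  suff [] : K j y /\ conn a (prodset F (prodset F F)) (V j `&` Z') x y by [].
  apply: (@conn_ind _ _ _ _ _ _ _ (fun y => K j y /\
    conn a (prodset F (prodset F F)) (V j `&` Z') x y)) xy.
    by split=> //; apply: conn_refl; split; [exact: KV|exact: ZZ'].
  move=> u v _ [Vv Zv] [Ku xu] /stepP[g gF uv].
  have Kv : K j v.
    apply: (@mult_eq k K (hat K) v _ _ j jk).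
    - by move=> l; apply: sub_hat.
    - exact: leq_trans Vv (Kq v).
    - by exists g^-1%g; rewrite ?symclosureV// -uv actK.
  split=> //; apply: conn_step xu _ _; last by split; [exact: KV|exact: ZZ'].
  rewrite -uv; apply: step_mem; rewrite -[g]mul1g -[g]mulg1.
  by do 2?apply: mem_prodset.
exists (prodset F (prodset T F) ++ T), W; split=> [j|x|j Z iZ].
- rewrite /W; case: ifP => _; last exact: mult_usc.
  apply: open_near => x [g gF Vgx].
  have := near_act (open_nbhs_nbhs (conj (oV j) Vgx)).
  by apply: filterS => w Vgw; exists g.
- rewrite multW; case: asboolP => [_|/negP]; rewrite ?addn1 ?addn0.
    by apply: leq_trans (Vq x) _; apply: mult_le => j _; apply: sub_hat.
  rewrite -ltnNge => /leq_trans; apply; apply: mult_le => j _ [g gF Kx].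
  by exists g => //; apply: KV.
- rewrite /W; case: ifP => _.
    apply: ctrl_sub (hatVT j Z iZ) => //; first exact: symclosure_sub.
    by move=> g gT; rewrite mem_cat gT.
  apply: ctrl_sub (VnewT Z iZ) => //; first exact: symclosure_sub.
  by move=> g gT; rewrite mem_cat gT orbT.
Qed.

Lemma bounded_familyD k q r : (0 < q)%N -> bounded_family k q ->
  bounded_family (r + k) (r + q).
Proof.
move=> q0 famq; elim: r => // r IH; rewrite !addSn; apply: bounded_familyS => //.
by rewrite (leq_trans q0)// leq_addl.
Qed.

Lemma mult_gt0_cover k V x : (exists2 j, (j <= k)%N & V j x) ->
  (0 < mult k.+1 V x)%N.
Proof.
move=> [j jk Vx]; rewrite /mult (bigD1 (Ordinal (jk : (j < k.+1)%N)))//=.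
by rewrite asboolT.
Qed.

End Multiplicity.

(** * Covers over thin sets *)

Lemma near_neq {R : realType} {X : topologicalType} {Y : metricType R}
    (u v : X -> Y) x : continuous u -> continuous v -> u x <> v x ->
  \forall w \near x, u w <> v w.
Proof.
move=> cu cv uv; have r0 : (0 < mdist (u x) (v x) / 2)%R.
  by rewrite divr_gt0// mdist_gt0; apply/eqP.
have nu := cu x _ (nbhsx_ballx (u x) _ r0).
have nv := cv x _ (nbhsx_ballx (v x) _ r0).
near=> w => uvw.
have uw : ball (u x) (mdist (u x) (v x) / 2)%R (u w) by near: w.
have vw : ball (v x) (mdist (u x) (v x) / 2)%R (v w) by near: w.
have := ball_triangle uw (ball_sym (eq_ind_r _ vw uvw)).
by rewrite -splitr ballEmdist/= ltxx.
Unshelve. all: by end_near. Qed.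

Lemma seq_argmin {d} {T : orderType d} (U : eqType) (h : U -> T) u (s : seq U) :
  exists2 z, z \in u :: s & forall w, w \in u :: s -> (h z <= h w)%O.
Proof.
elim: s u => [|v s IH] u.
  by exists u; rewrite ?mem_head// => w; rewrite inE => /eqP ->.
have [z zs zmin] := IH v; have [uz|/ltW zu] := leP (h u) (h z).
  exists u; first exact: mem_head.
  move=> w; rewrite inE => /orP[/eqP ->//|/zmin]; exact: le_trans.
exists z; first by rewrite inE zs orbT.
by move=> w; rewrite inE => /orP[/eqP ->//|/zmin].
Qed.

Section EquivariantMap.
Context {R : realType} {Gamma Lambda : groupType} {X Y : metricType R}.
Variables (a : homeo_action Gamma X) (b : homeo_action Lambda Y) (f : X -> Y).
Variable alpha : discrete_topology Gamma * X -> discrete_topology Lambda.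
Hypothesis countable_Lambda : countable [set: Lambda].
Hypotheses (compact_X : compact [set: X]) (compact_Y : compact [set: Y]).
Hypotheses (continuous_f : continuous f) (continuous_alpha : continuous alpha).
Hypothesis f_alpha : forall g x, f (a g x) = b (alpha (g, x)) (f x).
Variables m n : nat.
Hypothesis dim_f : forall A, DAD b A = 0%E ->
  (DAD a (f @^-1` A) < m.+1%:R%:E)%E.
Hypothesis dim_b : (DAD_action b < n.+1%:R%:E)%E.
Implicit Types (E F T : seq Gamma) (S : seq Lambda) (x w : X) (y : Y).

Lemma near_alpha g x : \forall w \near x, alpha (g, w) = alpha (g, x).
Proof.
have agx : nbhs (alpha (g, x)) [set alpha (g, x)].
  by apply: open_nbhs_nbhs; split => //; exact: discrete_open.
have [[A B] [/= /nbhs_singleton Ag xB] AB] := continuous_alpha agx.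
by apply: filterS xB => w Bw; exact: (AB (g, w)).
Qed.

Lemma short_orbit_base y S : (forall s, s \in S -> b s y = y) ->
  exists N, \forall v \near y, short_orbit b S N v.
Proof.
move=> Sy; have [T [U [oU UT UST]]] := DAD_action_covers dim_b S.
have [j _ Uy] := UT y; exists (size T).
have UST' : ctrl b S (U j `&` setT) T by rewrite setIT.
apply: filterS (near_fixed_point UST' (oU j) Uy Sy) => v vT.
by apply: contrapT => /not_short_orbit[p [vp up pT]]; apply: (vT p).
Qed.

(* Otherwise there are [w k] tending to [x] with long [E]-orbits; the base
   points of these orbits lie in a thin set, and over it a bounded open cover
   must bound the orbits near the fixed point [x]. *)
Lemma short_orbit_total x E : (forall e, e \in E -> a e x = x) ->
  exists N, \forall w \near x, short_orbit a E N w.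
Proof.
move=> Ex; apply: contrapT => nN.
pose E' := [seq (alpha (e, x) : Lambda) | e <- E].
have E'x s : s \in E' -> b s (f x) = f x.
  by move=> /mapP[e eE ->]; rewrite -f_alpha Ex.
have [N' yN'] := short_orbit_base E'x.
have /choice[w wP] (k : nat) : exists w, ball x (k.+1%:R^-1)%R w /\
    exists p, [/\ path (step a E) w p, uniq (w :: p) & size p = k].
  apply: contrapT => nw; apply: nN; exists k.
  have k0 : (0 < k.+1%:R^-1 :> R)%R by rewrite invr_gt0.
  apply: filterS (nbhsx_ballx x _ k0) => w xw.
  by apply: contrapT => /not_short_orbit wp; apply: nw; exists w.
have wx V : nbhs x V -> exists K, forall k, (K <= k)%N -> V (w k).
  move=> /nbhs_ballP[e /= e0 xeV]; exists (Num.trunc e^-1) => k Kk.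
  apply/xeV/(le_ball _ (wP k).1); rewrite -[e]invrK lef_pV2 ?posrE ?invr_gt0//.
  apply/ltW/(lt_le_trans (truncnS_gt _)); rewrite ler_nat ltnS; exact: Kk.
have [I [Iinf thinA]] := thin_subsequence b countable_Lambda (f \o w) (f x)
  (words E' N').
set A := [set y | _] in thinA.
have [T [U [oU AU UET]]] := DAD_covers (dim_f thinA) E.
have [|j _ Ux] := AU x; first by left.
have near1 := near_fixed_point (UET j) (oU j) Ux Ex.
(* Words in [E] fix [x], so they keep [w] close to [x], and along this orbit the cocycle takes the
   values it has at [x]. *)
have near2 : \forall w \near x, forall g, g \in words E (size T) ->
    forall e, e \in E -> alpha (e, a g w) = alpha (e, x).
  apply: near_seq => g gE; apply: near_seq => e eE.
  apply: (@near_act _ _ _ a g x (fun z => alpha (e, z) = alpha (e, x))).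
  by rewrite (words_fix Ex gE); apply: near_alpha.
have near3 : \forall w \near x, short_orbit b E' N' (f w).
  exact: continuous_f yN'.
have [K KP] := wx _ (filterI near1 (filterI near2 near3)).
have [k + Ik] := Iinf (maxn K (size T)); rewrite geq_max => /andP[Kk Tk].
have [wT [walpha wN']] := KP _ Kk.
have [_ [p [wp up pk]]] := wP k.
(* The long path is cut to exactly the length that [near1] excludes; its image is an [E']-path from
   [f (w k)] and therefore stays in [A]. *)
pose q := take (size T) p.
have qT : size q = size T by apply: size_takel; rewrite pk.
have wq : path (step a E) (w k) q by apply: take_path.
apply: (wT q) => // [z zq|]; last exact: (take_uniq (size T).+1 up).
right; exists k => //=; apply: short_orbit_conn wN' _.
have fwq : path (step b E') (f (w k)) (map f q).
  apply/(pathP (f (w k))) => i; rewrite size_map => iq.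
  have /pathP - /(_ (w k) i iq) /stepP[e eE] := wq.
  have : step a (words E (size T)) (w k) (nth (w k) (w k :: q) i).
    by apply: (mem_path_words wq); rewrite ?qT// mem_nth// ltnW.
  move=> /stepP[g gE gi] ei; rewrite (nth_map (w k)) //.
  have -> : nth (f (w k)) (f (w k) :: map f q) i = f (nth (w k) (w k :: q) i).
    by rewrite -(nth_map (w k) (f (w k)) f) //= ltnS ltnW.
  rewrite -ei f_alpha -gi walpha//.
  exact/step_mem/map_f.
apply: (conn_path fwq) => //; exact: (map_f f zq).
Qed.

(** The bound at a cluster point [x] serves nearby points too, because an element of [F] that fixes
    a point close enough to [x] fixes [x] itself. *)
Lemma uniform_short_orbit F : exists N, forall x, \forall w \near x,
  short_orbit a [seq g <- F | a g x == x] N w.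
Proof.
apply: contrapT => nN; pose E x := [seq g <- F | a g x == x].
have /choice[u uP] (N : nat) : exists x, ~ \forall w \near x,
    short_orbit a (E x) N w.
  by apply: contrapT => nx; apply: nN; exists N => x; apply: contrapT => Nx;
     apply: nx; exists x.
have [x cx] := seq_cluster compact_X u.
have [|N xN] := @short_orbit_total x (E x).
  by move=> e; rewrite mem_filter => /andP[/eqP].
have xE : \forall w \near x, forall g, g \in F -> a g w = w -> a g x = x.
  apply: near_seq => g gF; have [->|gx] := pselect (a g x = x).
    by near=> w.
  have := @near_neq _ _ _ (a g) id x (@act_continuous _ _ a g) _ gx.
  by move=> /(_ (fun=> cvg_id)); apply: filterS => w gw /gw.
have [k Nk [ukN ukE]] := cx _ (filterI (nbhs_interior xN) xE) N.
apply: (uP k); apply: filterS ukN => w wN p wp up.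
apply: leq_trans Nk; apply: wN => //; apply: sub_path wp => z z'.
apply: sub_step => g; rewrite !mem_filter => /andP[/eqP gu gF].
by rewrite gF ukE ?eqxx.
Unshelve. all: by end_near. Qed.

(* The covers of the preimage of the thin set [S S^-1 A] extend to open sets of
   [X]: every centre [x] carries a ball of radius [r x] in the metric
   [max_(g in P) d (a g _) (a g _)], and a chain in the union of these balls is
   compared with its translate starting from the centre whose radius is the
   smallest along the chain. *)
Lemma transversal_cover (A : set Y) F S : 1%g \in S ->
  (forall y l, A y -> A (b l y) -> b l y = y) ->
  exists T, exists V : nat -> set X, [/\ forall j, open (V j),
    forall x, A (f x) -> exists2 j, (j <= m)%N & V j x &
    forall j y, ctrl a F (V j `&` f @^-1` [set z | step b S y z]) T].
Proof.
wlog [F1 FV] : F / 1%g \in F /\ forall g, g \in F -> g^-1%g \in F.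
  move=> WF S1 Atr.
  have [T [V [oV AV FVT]]] :=
    WF (symclosure F) (conj (mem_head _ _) (@symclosureV _ F)) S1 Atr.
  exists T, V; split=> // j y; apply: ctrl_sub (FVT j y) => //.
  exact: symclosure_sub.
(* Two points [s1 y] and [s2 y] over the same set [S y] differ by [s2 s1^-1]. *)
move=> S1 Atr; pose S' := prodset S (invset S).
pose B := [set y | exists2 y0, A y0 & step b S' y0 y].
have AB y : A y -> B y.
  move=> Ay; exists y => //; apply/stepP; exists (1 * 1^-1)%g.
    by apply: mem_prodset => //; apply: map_f.
  by rewrite mulgV act1.
(* A component of [B] stays in one orbit, which meets [A] in a single point [y0], so it lies in
   [S' y0]. *)
have thinB : DAD b B = 0%E.
  apply: DAD_eq0_seq => F0; exists (size S') => y [y0 Ay0 /stepP[s sS <-]].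
  exists [seq b s y0 | s <- S']; split; first by rewrite size_map.
  move=> z yz; have [l zl] : exists l, z = b l y0.
    apply: (@conn_ind _ _ _ _ _ _ _ (fun z => exists l, z = b l y0)) yz.
      by exists s.
    by move=> u v _ _ [l ->] /stepP[g _ <-]; exists (g * l)%g; rewrite actM.
  have [_ [y1 Ay1 /stepP[s1 s1S s1z]]] := conn_mem yz.
  have y1E : y1 = b (s1^-1 * l)%g y0 by rewrite actM -zl -s1z actK.
  by apply/mapP; exists s1 => //; rewrite -s1z y1E (Atr y0)// -y1E.
have [T0 [U [oU BU UT0]]] := DAD_covers (dim_f thinB) F.
pose T := 1%g :: T0.
(* [D] contains the corrections [t'^-1 g t] between representatives in [T], [N] bounds the orbits
   near a centre of those that fix it, and [P] covers all displacements that occur. *)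
pose D := prodset (invset T) (prodset F T).
have [N xN] := uniform_short_orbit D.
pose P := prodset F (prodset T (words D N)).
have P1 : 1%g \in P.
  rewrite -[1%g]mulg1 -[X in (_ * X)%g]mulg1.
  by do 2?apply: mem_prodset; rewrite ?mem_head ?words1.
(* What persists near a centre: short orbits under its stabilising elements of [D], the cocycle
   values, and the rule that a coincidence in the base at [w] already holds at [x]. *)
pose good x w := [/\ short_orbit a [seq g <- D | a g x == x] N w,
  forall g, g \in P -> alpha (g, w) = alpha (g, x) &
  forall g, g \in P -> forall s, s \in S' ->
    b (alpha (g, x)) (f w) = b s (f w) -> b (alpha (g, x)) (f x) = b s (f x)].
have /choice[r rP] (jx : nat * X) : exists r : R, U jx.1 jx.2 ->
    [/\ (0 < r)%R, ball jx.2 (r + r) `<=` U jx.1 & forall w,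
      (forall g, g \in P -> ball (a g jx.2) r (a g w)) -> good jx.2 w].
  case: jx => j x /=; have [Ux|] := pselect (U j x); last by exists 0%R.
  have [r1 r10 xr1] := nbhs_double_ball (oU j) Ux.
  have /nbhs_ballP[r2 /= r20 xr2] : \forall w \near x, good x w.
    near=> w; split; first by near: w; apply: xN.
    - move=> g gP; move: g gP; near: w; apply: near_seq => g _.
      exact: near_alpha.
    - move=> g gP; move: g gP; near: w; apply: near_seq => g _.
      apply: near_seq => s _.
      have [gs|gs] := pselect (b (alpha (g, x)) (f x) = b s (f x)).
        by near=> w.
      have bf l : continuous (b l \o f).
        by move=> z; apply: continuous_comp;
          [exact: continuous_f|exact: act_continuous].
      have := near_neq (bf (alpha (g, x))) (bf s) gs.
      by apply: filterS => w /= gsw /gsw.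
  exists (Order.min r1 r2) => _; split; first by rewrite lt_min r10.
    move=> z /(le_ball _) xz; apply/xr1/xz.
    by apply: lerD; rewrite ge_min lexx.
  move=> w /(_ _ P1); rewrite !act1 => xw; apply: xr2.
  by apply: le_ball xw; rewrite ge_min lexx orbT.
pose center j x w := [/\ U j x, A (f x) &
  forall g, g \in P -> ball (a g x) (r (j, x)) (a g w)].
pose V j := [set w | exists x, center j x w].
exists (prodset P (invset P)), V; split=> [j|x Ax|j y].
- apply: open_near => w [x [Ux Ax xw]].
  suff : \forall w' \near w, forall g, g \in P -> ball (a g x) (r (j, x)) (a g w').
    by apply: filterS => w' xw'; exists x.
  apply: near_seq => g /xw gxw; apply: near_act; apply: open_nbhs_nbhs.
  by split=> //; apply: open_metric_ball.
- have [j jm Ux] := BU _ (AB _ Ax); exists j => //; exists x; split=> // g _.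
  by apply: ballxx; have [] := rP (j, x) Ux.
pose Z := V j `&` f @^-1` [set z | step b S y z].
have /choice[c cP] (w : X) : exists x, V j w -> center j x w.
  by have [[x xw]|nw] := pselect (V j w); [exists x|exists w].
pose rho w := r (j, c w).
have tracked z w : conn a F [set w | Z w /\ (rho z <= rho w)%R] z w -> step a P z w.
  move=> zw; have [[[Vz Sz] _] _] := conn_mem zw.
  have [Uz Az cz] := cP _ Vz; set x := c z in Uz Az cz.
  have [r0 xrU /(_ z cz)[zN zalpha zs]] := rP (j, x) Uz.
  pose E := [seq g <- D | a g x == x].
  have ED : {subset words E N <= words D N}.
    by apply: words_sub => g; rewrite mem_filter => /andP[].
  have Ex h : h \in words E N -> a h x = x.
    by apply: words_fix => e; rewrite mem_filter => /andP[/eqP].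
  (* Invariant along the chain: the current point is [t h z], where [h] fixes the centre [x], and
     the translated chain of [x] reaches [t x] inside [U j] over [B]. *)
  have : exists t h, [/\ t \in T, h \in words E N, w = a t (a h z) &
      conn a F (U j `&` f @^-1` B) x (a t x)].
    apply: (@conn_ind _ _ _ _ _ _ _ (fun w => exists t h, [/\ t \in T,
      h \in words E N, w = a t (a h z) &
      conn a F (U j `&` f @^-1` B) x (a t x)])) zw.
      exists 1%g, 1%g; rewrite !act1; split; [exact: mem_head|exact: words1|by []|].
      by apply: conn_refl; split; last exact: AB.
    move=> u v [[_ Su] _] [[Vv Sv] zv] [t [h [tT hE uE xt]]] /stepP[g gF uv].
    pose k := (g * (t * h))%g.
    have kP : k \in P by do 2?apply: mem_prodset => //; apply: ED.
    have vE : v = a k z by rewrite !actM -uE.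
    have kx : a k x = a g (a t x) by rewrite !actM Ex.
    (* [k x] is within [rho z] of [v], and [v] is within [rho v] of its own centre; as [rho z] is
       the smaller radius, the double ball around that centre contains [k x]. *)
    have Ukx : U j (a k x).
      have [Uv _ /(_ _ P1)] := cP _ Vv; rewrite !act1 => cv.
      have [_ + _] := rP (j, c v) Uv; apply => /=.
      apply: le_ball (ball_triangle cv (ball_sym _)); last first.
        by rewrite vE; apply: (cz k kP).
      by rewrite lerD2l; apply: zv.
    (* [f v] arises from [f z] by [s2 s1^-1] and also by the cocycle value at [k]; [good] transfers
       this coincidence to [f x]. *)
    have Bkx : B (f (a k x)).
      exists (f x) => //.
      move: Sv => /stepP[s2 s2S sv]; move: Sz => /stepP[s1 s1S sz].
      have sS' : (s2 * s1^-1)%g \in S' by apply: mem_prodset => //; apply: map_f.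
      apply/stepP; exists (s2 * s1^-1)%g => //.
      rewrite f_alpha (zs _ kP _ sS')// -(zalpha _ kP) -f_alpha -vE.
      by rewrite -sz actM actK.
    have xkx : conn a F (U j `&` f @^-1` B) x (a k x).
      by apply: conn_step xt _ _ => //; rewrite kx; apply: step_mem.
    have /UT0/stepP[t' t'T t'x] := xkx.
    (* The representative [t'] with [t' x = k x] replaces [g t]. The correction [e] fixes [x], and
       the short orbit of [z] lets a word of length at most [N] act on [z] as [e h] does, so words
       do not grow. *)
    pose e := (t'^-1 * (g * t))%g.
    have eE : e \in E.
      rewrite mem_filter !actM -kx -t'x actK eqxx.
      apply: mem_prodset; first by apply: map_f; rewrite inE t'T orbT.
      exact: mem_prodset.
    have /(short_orbit_conn zN)/stepP[h' h'E h'z] : conn a E setT z (a e (a h z)).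
      apply: (conn_step (y := a h z)) => //.
        exact: (words_conn _ _ hE).
      exact: step_mem.
    exists t', h'; split=> //; first by rewrite inE t'T orbT.
      by rewrite h'z -actM mulgA mulgV mul1g -uv uE !actM.
    by rewrite t'x.
  move=> [t [h [tT hE -> _]]]; rewrite -actM; apply: step_mem.
  rewrite -[(t * h)%g]mul1g; do 2?apply: mem_prodset => //; exact: ED.
move=> x w [p [xp pZ pw]].
(* Both ends of the chain are tracked from its point of smallest radius. *)
have [z zp zmin] := seq_argmin rho x p.
have pZ' u : u \in x :: p -> Z u /\ (rho z <= rho u)%R.
  by move=> up; split; [exact: pZ|exact: zmin].
have xz := conn_path xp pZ' zp.
have xw : conn a F [set w | Z w /\ (rho z <= rho w)%R] x w.
  by rewrite -pw; apply: (conn_path xp pZ'); apply: mem_last.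
have zx := conn_sym FV xz.
exact: step_prod (step_inv (tracked _ _ zx)) (tracked _ _ (conn_trans zx xw)).
Unshelve. all: by end_near. Qed.

Lemma fiber_cover F S : 1%g \in S ->
  exists T, exists V : nat -> set X, [/\ forall j, open (V j),
    forall x, exists2 j, (j <= m)%N & V j x &
    forall j y, ctrl a F (V j `&` f @^-1` [set z | step b S y z]) T].
Proof.
move=> S1; have [e eP] := countable_enum countable_Lambda.
pose orb y := [set z | exists l, z = b l y].
have orbE y l : orb (b l y) = orb y.
  apply/seteqP; split=> _ [k ->]; first by exists (k * l)%g; rewrite actM.
  by exists (k * l^-1)%g; rewrite actM actK.
(* The point is chosen as a function of the set, so that points of the same orbit share it. *)
have /choice[rep repP] (C : set Y) : exists o, forall z, C z ->
    exists2 c, C c & o = Some c.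
  have [[c Cc]|nC] := pselect (exists c, C c); first by exists (Some c); exists c.
  by exists None => z Cz; case: nC; exists z.
pose A p := [set y | let y' := b (e p)^-1%g y in rep (orb y') = Some y'].
have A_inj p y l : A p y -> A p (b l y) -> b l y = y.
  rewrite /A /= !orbE => -> [] /(congr1 (b (e p))).
  by rewrite !actKV.
have A_cover y : exists p, A p y.
  have [|_ [l ->] ry] := repP (orb y) y; first by exists 1%g; rewrite act1.
  have [c /(_ l^-1%g (mem_head _ _))[p _ lp]] := eP [:: l^-1%g].
  by exists p; rewrite /A /= -lp invgK orbE.
(* The bound, the set of base points already treated, and the cover over it. *)
pose state := (seq Gamma * set Y * (nat -> set X))%type.
pose valid (s : state) := [/\ open s.1.2, forall j, open (s.2 j),
  forall x, s.1.2 (f x) -> exists2 j, (j <= m)%N & s.2 j x &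
  forall j y, ctrl a F (s.2 j `&` f @^-1` [set z | step b S y z]) s.1.1].
have /choice[nxt nxtP] (ps : nat * state) : exists s', valid ps.2 ->
    [/\ valid s', ps.2.1.2 `<=` s'.1.2 & A ps.1 `<=` s'.1.2].
  case: ps => p s; have [vs|] := pselect (valid s); last by exists s.
  (* The scale of the new cover absorbs the present bound, as [ctrl_setU] requires. *)
  have [T2 [V2 [oV2 AV2 FV2]]] := transversal_cover
    (F ++ prodset F (prodset s.1.1 F)) S1 (A_inj p).
  pose W := [set x | exists2 j, (j <= m)%N & V2 j x].
  have oW : open W.
    apply: open_near => x [j jm Vx].
    by apply: filterS (open_nbhs_nbhs (conj (oV2 j) Vx)) => w Vw; exists j.
  (* [W] contains the fibres over the translate, hence all fibres over an open set around it. *)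
  have oO2 := tube compact_X continuous_f oW.
  have [oO oV OV FV] := vs.
  exists (s.1.1 ++ prodset (1%g :: prodset s.1.1 F)
    (prodset T2 (1%g :: prodset F s.1.1)),
    s.1.2 `|` [set y | forall x, f x = y -> W x], fun j => s.2 j `|` V2 j) => _.
  split=> [|y|y Ay]; last first.
  - by right=> x xy; apply: AV2; rewrite xy.
  - by left.
  split=> [|j|x [/OV[j jm Vx]|/(_ _ erefl)[j jm Vx]]|j y] /=.
  - exact: openU.
  - exact: openU.
  - by exists j => //; left.
  - by exists j => //; right.
  - rewrite setIUl; exact: ctrl_setU (FV j y) (FV2 j y).
pose st := fix st p := if p is p'.+1 then nxt (p', st p')
  else ([::], set0, fun=> set0) : state.
have stP p : valid (st p).
  elim: p => [|p IH]; last by have [] := nxtP (p, st p) IH.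
  by split=> //=; [exact: open0|move=> _; exact: open0|
    by move=> j y x x' xx'; have [[]] := conn_mem xx'].
have st_le p q : (p <= q)%N -> (st p).1.2 `<=` (st q).1.2.
  move=> /subnK <-; elim: (q - p)%N => // d IH y /IH.
  by have [_ /(_ y) + _] := nxtP ((d + p)%N, st (d + p)%N) (stP (d + p)%N).
(* Otherwise untreated points have a cluster point, which some stage treats together with a
   neighbourhood. *)
have [p Op] : exists p, forall y, (st p).1.2 y.
  apply: contrapT => nO; have /choice[u uP] (p : nat) : exists y, ~ (st p).1.2 y.
    apply: contrapT => ny; apply: nO; exists p => y.
    by apply: contrapT => Oy; apply: ny; exists y.
  have [y cy] := seq_cluster compact_Y u.
  have [p Ay] := A_cover y.
  have [_ _ /(_ _ Ay) Oy] := nxtP (p, st p) (stP p).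
  have [oO _ _ _] := stP p.+1.
  have [k pk Ok] := cy _ (open_nbhs_nbhs (conj oO Oy)) p.+1.
  by apply: (uP k); apply: st_le pk _ Ok.
have [_ oV OV FV] := stP p.
by exists (st p).1.1, (st p).2; split=> // x; apply/OV/Op.
Qed.

(** * Combination of the covers of the two spaces *)

Lemma alpha_finite F : exists S, forall g x, g \in F -> alpha (g, x) \in S.
Proof.
elim: F => [|g F [S SP]]; first by exists [::].
have [e eP] := countable_enum countable_Lambda.
(* For fixed [g] the cocycle is locally constant, hence finitely valued on the compact [X]. *)
have [N NP] : exists N, forall x, alpha (g, x) \in [seq e i | i <- iota 0 N].
  apply: contrapT => nN; have /choice[u uP] (N : nat) : exists x,
      ~ alpha (g, x) \in [seq e i | i <- iota 0 N].
    apply: contrapT => nx; apply: nN; exists N => x.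
    by apply: contrapT => gx; apply: nx; exists x.
  have [x cx] := seq_cluster compact_X u.
  have [c /(_ _ (mem_head _ _))[i ic gx]] := eP [:: alpha (g, x) : Lambda].
  have [k ck gk] := cx _ (near_alpha g x) c; apply: (uP k).
  by rewrite gk gx map_f// mem_iota (leq_trans ic).
exists ([seq e i | i <- iota 0 N] ++ S) => h x.
rewrite inE mem_cat => /orP[/eqP ->|hF]; first by rewrite NP.
by rewrite SP ?orbT.
Qed.

Lemma DAD_action_add : (DAD_action a <= (m + n)%:R%:E)%E.
Proof.
pose fibers S := [set Z : set X | exists y, Z = f @^-1` [set z | step b S y z]].
have enlX F S : exists S', forall Z, fibers S Z ->
    exists2 Z', fibers S' Z' & forall g z, g \in F -> Z z -> Z' (a g z).
  have [F' F'P] := alpha_finite F; exists (prodset F' S) => _ [y ->].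
  exists (f @^-1` [set z | step b (prodset F' S) y z]); first by exists y.
  move=> g z gF yz; rewrite /= f_alpha; apply: step_prod yz _.
  exact/step_mem/F'P.
have enlY S (i : unit) : exists i' : unit, forall Z : set Y, Z = setT ->
    exists2 Z', Z' = setT & forall g z, g \in S -> Z z -> Z' (b g z).
  by exists tt => _ ->; exists setT.
have famX : bounded_family a fibers m.+1 1.
  move=> F S; have [T [V [oV VT FVT]]] := fiber_cover F (mem_head 1%g S).
  exists T, V; split=> // [x|j _ [y ->]]; first exact/mult_gt0_cover/VT.
  apply: ctrl_sub (FVT j y) => // x [Vx yx]; split=> //.
  by apply: sub_step yx => g gS; rewrite inE gS orbT.
have famY : bounded_family b (fun _ : unit => [set setT]) n.+1 1.
  move=> S i; have [T [U [oU UT SUT]]] := DAD_action_covers dim_b S.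
  exists T, U; split=> // [y|j Z ->]; first exact/mult_gt0_cover/UT.
  by rewrite setIT.
have {}famX := bounded_familyD compact_X enlX n (ltn0Sn 0) famX.
have {}famY := bounded_familyD compact_Y enlY m (ltn0Sn 0) famY.
apply: DAD_action_le => F; have [S FS] := alpha_finite F.
(* The bound [TY] in the base comes first: it is the scale over which [V] must be bounded. *)
have [TY [U [oU Un SUT]]] := famY S tt.
have [T [V [oV Vm FVT]]] := famX F TY.
exists T, (fun j => f @^-1` U j `&` V j); split=> [j|x|j x y xy].
- apply: openI (open_comp _ (oU j)) (oV j) => z _; exact: continuous_f.
- apply: contrapT => nUV.
  (* Pigeonhole: without a common index the multiplicities add up to at most [m + n + 1], but they
     are at least [m + 1] and [n + 1]. *)
  have : (mult (m + n).+1 U (f x) + mult (m + n).+1 V x <= (m + n).+1)%N.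
    rewrite /mult -big_split /= -[leqRHS]card_ord -sum1_card.
    apply: leq_sum => j _; case: asboolP => Ux; last exact: leq_b1.
    by rewrite asboolF// => Vx; apply: nUV; exists j => //; rewrite -ltnS.
  move: (Vm x) (Un (f x)); rewrite (addnS n m) (addnC n m) (addnS m n) => Vx Ux.
  apply/negP; rewrite -ltnNge; apply: leq_trans (leq_add Ux Vx).
  by rewrite !addn1 addSn addnS.
have [[Ux _] _] := conn_mem xy.
apply: (FVT j (f @^-1` [set z | step b TY (f x) z])); first by exists (f x).
have UT : ctrl b S (U j) TY by rewrite -[U j]setIT; apply: SUT.
(* The image of the chain is an [S]-chain in [U j], so the chain stays over [TY (f x)], where [V j]
   is bounded. *)
suff [] : conn b S (U j) (f x) (f y) /\
    conn a F (V j `&` f @^-1` [set z | step b TY (f x) z]) x y by [].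
have Vx : V j x by have [[]] := conn_mem xy.
apply: (@conn_ind _ _ _ _ _ _ _ (fun w => conn b S (U j) (f x) (f w) /\
    conn a F (V j `&` f @^-1` [set z | step b TY (f x) z]) x w)) xy.
  have xx := conn_refl b S Ux; split=> //; apply: conn_refl.
  by split=> //; apply: UT.
move=> u v _ [Uv Vv] [fxu xu] /stepP[g gF uv].
have fxv : conn b S (U j) (f x) (f v).
  apply: conn_step fxu _ Uv; rewrite -uv f_alpha; apply: step_mem; exact: FS.
split=> //; apply: conn_step xu _ _; last by split=> //; apply: UT.
by rewrite -uv; apply: step_mem.
Qed.

End EquivariantMap.

Theorem theorem1 (R : realType) (Gamma Lambda : groupType)
    (countable_Gamma : countable [set: Gamma])
    (countable_Lambda : countable [set: Lambda])
    (X Y : metricType R)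
    (compact_X : compact [set: X]) (compact_Y : compact [set: Y])
    (a : homeo_action Gamma X) (b : homeo_action Lambda Y)
    (f : X -> Y)
    (alpha : discrete_topology Gamma * X -> discrete_topology Lambda)
    (continuous_f : continuous f) (continuous_alpha : continuous alpha)
    (f_alpha : forall (g : Gamma) (x : X), f (a g x) = b (alpha (g, x)) (f x)) :
  (DAD_action a <= DAD_map a b f + DAD_action b)%E.
Proof.
have b0 : (0 <= DAD_action b)%E by exact: least_dim_ge0.
(* The empty set has dimension 0, so the supremum is over a nonempty family. *)
have f0 : (0 <= DAD_map a b f)%E.
  apply: le_trans (least_dim_ge0 _ _ : 0 <= DAD a (f @^-1` set0))%E _.
  apply: ereal_sup_ubound; exists set0 => //=; apply: DAD_eq0 => F.
  by exists [::] => x y xy; have [] := conn_mem xy.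
have ub A : DAD b A = 0%E -> (DAD a (f @^-1` A) <= DAD_map a b f)%E.
  by move=> A0; apply: ereal_sup_ubound; exists A.
case: (DAD_map a b f) f0 ub => [r|_ _|//]; last first.
  by rewrite addye ?leey// gt_eqF// (lt_le_trans _ b0)// ltNyr.
rewrite lee_fin => r0 ub.
move: b0; case bE : (DAD_action b) => [s| |] // s0; last by rewrite addey ?leey.
rewrite lee_fin in s0.
(* The truncations serve as [m] and [n]: what is at most [r] lies below its truncation plus one. *)
have rP := truncn_itv r0; have sP := truncn_itv s0.
apply: le_trans (_ : (Num.trunc r + Num.trunc s)%:R%:E <= _)%E; last first.
  rewrite -EFinD lee_fin natrD lerD//.
  - by case/andP: rP.
  - by case/andP: sP.
apply: (DAD_action_add countable_Lambda compact_X compact_Y continuous_f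
  continuous_alpha f_alpha) => [A /ub Ar|].
  by apply: le_lt_trans Ar _; rewrite lte_fin truncnS_gt.
by rewrite bE lte_fin truncnS_gt.
Qed.
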